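(* Let $A$ be a regular (Noetherian) ring containing a field of characteristic $p>0$, and let $R=A[X_1,\ldots,X_n]$ be the standard $\mathbb{N}^n$-graded polynomial ring over $A$, i.e., $\deg(A)=\underline{0}\in\mathbb{N}^n$ and $\deg(X_j)=e_j\in\mathbb{N}^n$. Assume that $M=\bigoplus_{\underline{u}\in\mathbb{Z}^n}M_{\underline{u}}$ is a $\mathbb{Z}^n$-graded $\mathcal{F}$-finite $\mathcal{F}$-module over $R$. If $M_{\underline{u}}=0$ for all $|u_i|\gg 0$, then $M=0$.
   Context: Here $\underline{u}=(u_1,\ldots,u_n)\in\mathbb{Z}^n$ and $e_j$ is the $j$-th standard basis vector of $\mathbb{Z}^n$. For a regular Noetherian ring $R$ of characteristic $p>0$, let $R^1$ be the $(R,R)$-bimodule which is $R$ as an additive group, with the usual left multiplication and with right multiplication through the Frobenius map $a\mapsto a^p$. The Frobenius functor on $R$-modules is $\mathcal{F}(M)=R^1\otimes_R M$, $\mathcal{F}(f)=\mathrm{id}\otimes f$; $\mathcal{F}^e$ denotes its $e$-th iterate. An $\mathcal{F}$-module over $R$ is an $R$-module $M$ with an $R$-module isomorphism $\theta:M\to\mathcal{F}(M)$. An $\mathcal{F}$-module is $\mathcal{F}$-finite if it is of the form $M=\varinjlim\left(U\xrightarrow{\beta}\mathcal{F}(U)\xrightarrow{\mathcal{F}(\beta)}\mathcal{F}^2(U)\to\cdots\right)$ for a finitely generated $R$-module $U$ and an $R$-linear map $\beta:U\to\mathcal{F}(U)$ (a generating morphism), with the induced isomorphism $M\cong\mathcal{F}(M)$.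 If $M$ is a $\mathbb{Z}^n$-graded $R$-module, then $\mathcal{F}(M)$ is $\mathbb{Z}^n$-graded by $\deg(r\otimes m)=\deg(r)+p\deg(m)$ for homogeneous $r\in R$, $m\in M$. An $\mathcal{F}$-finite $\mathcal{F}$-module $M$ is called $\mathbb{Z}^n$-graded if $M$ is $\mathbb{Z}^n$-graded and $\beta$ is degree preserving. *)

(* Defs.v *)
From HB Require Import structures.
From mathcomp Require Import all_boot all_order all_algebra.
From mathcomp Require Import ring_quotient.
From mathcomp Require Export boolp mpoly.

Set Implicit Arguments.
Unset Strict Implicit.
Unset Printing Implicit Defensive.

Import GRing.Theory.
Local Open Scope ring_scope.
Local Open Scope quotient_scope.

Definition lin_span (R : nzRingType) (V : lmodType R) (s : seq V) (x : V) : Prop :=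
  exists c : nat -> R, x = \sum_(i < size s) c i *: s`_i.

Definition finitely_generated (R : nzRingType) (V : lmodType R) : Prop :=
  exists s : seq V, forall x : V, lin_span s x.

(* The library predicate [idealr_closed] already entails properness. *)
Definition prime_ideal (B : comNzRingType) (P : {pred B}) : Prop :=
  idealr_closed P /\ prime_idealr_closed P.

Definition ideal_gen (B : comNzRingType) (I : {pred B}) (s : seq B) : Prop :=
  forall x : B, x \in I <-> lin_span (s : seq B^o) x.

(* The improper ideal is generated by 1, so proper ideals suffice. *)
Definition noetherian (B : comNzRingType) : Prop :=
  forall I : {pred B}, idealr_closed I -> exists s : seq B, ideal_gen I s.

Definition prime_chain (B : comNzRingType) (d : nat) (Q : nat -> {pred B}) : Prop :=
  (forall i, (i <= d)%N -> prime_ideal (Q i)) /\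
  (forall i, (i < d)%N ->
     {subset Q i <= Q i.+1} /\ exists x, x \in Q i.+1 /\ x \notin Q i).

Definition krull_dim (B : comNzRingType) (d : nat) : Prop :=
  (exists Q : nat -> {pred B}, prime_chain d Q) /\
  (forall e (Q : nat -> {pred B}), prime_chain e Q -> (e <= d)%N).

Definition unique_maximal_ideal (B : comNzRingType) (m : {pred B}) : Prop :=
  idealr_closed m /\
  forall I : {pred B}, idealr_closed I -> {subset I <= m}.

Definition regular_local (B : comNzRingType) : Prop :=
  noetherian B /\
  exists (m : {pred B}) (s : seq B),
    [/\ unique_maximal_ideal m, krull_dim B (size s) & ideal_gen m s].

Definition inverts_compl (A B : comNzRingType) (P : {pred A})
    (f : {rmorphism A -> B}) : Prop :=
  forall s, s \notin P -> exists t : B, f s * t = 1.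

(* [f : A -> B] exhibits [B] as the localization of [A] at the prime [P]. *)
Definition is_localization (A B : comNzRingType) (P : {pred A})
    (f : {rmorphism A -> B}) : Prop :=
  inverts_compl P f /\
  forall (C : comNzRingType) (g : {rmorphism A -> C}), inverts_compl P g ->
    exists h : {rmorphism B -> C}, (forall a, h (f a) = g a) /\
      forall h' : {rmorphism B -> C}, (forall a, h' (f a) = g a) -> h' =1 h.

Definition regular_ring (A : comNzRingType) : Prop :=
  noetherian A /\
  forall (P : {pred A}) (B : comNzRingType) (f : {rmorphism A -> B}),
    prime_ideal P -> is_localization P f -> regular_local B.

Section FrobeniusTensor.
Variables (R : comNzRingType) (p : nat) (M : lmodType R).

(* Finite formal sums of pairs (r, m), modulo the congruence that presents
   the tensor product of R (with right action r . s = r * s ^+ p) and M. *)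
Inductive frob_rel : seq (R * M) -> seq (R * M) -> Prop :=
| FrobRefl x : frob_rel x x
| FrobSym x y : frob_rel x y -> frob_rel y x
| FrobTrans x y z : frob_rel x y -> frob_rel y z -> frob_rel x z
| FrobCat x x' y y' : frob_rel x x' -> frob_rel y y' ->
    frob_rel (x ++ y) (x' ++ y')
| FrobCatC x y : frob_rel (x ++ y) (y ++ x)
| Frob0 m : frob_rel [:: (0, m)] [::]
| FrobDl r r' m : frob_rel [:: (r + r', m)] [:: (r, m); (r', m)]
| FrobDr r m m' : frob_rel [:: (r, m + m')] [:: (r, m); (r, m')]
| FrobBal r s m : frob_rel [:: (r * s ^+ p, m)] [:: (r, s *: m)].

Definition frob_eqb (x y : seq (R * M)) : bool := `[< frob_rel x y >].

Lemma frob_eqbP x y : reflect (frob_rel x y) (frob_eqb x y).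
Proof. exact: asboolP. Qed.

Lemma frob_eqb_equiv : equiv_class_of frob_eqb.
Proof.
split=> [x|x y|y x z]; first exact/frob_eqbP/FrobRefl.
  by apply/idP/idP => /frob_eqbP h; apply/frob_eqbP/FrobSym.
by move=> /frob_eqbP h /frob_eqbP h'; apply/frob_eqbP/(FrobTrans h).
Qed.

Canonical frob_equiv := EquivRelPack frob_eqb_equiv.

Definition frob : Type := {eq_quot frob_eqb}.

HB.instance Definition _ : EqQuotient (seq (R * M)) frob_eqb frob :=
  EqQuotient.on frob.
HB.instance Definition _ := Choice.on frob.

Definition frob_class (x : seq (R * M)) : frob := \pi_frob x.

Definition tens (r : R) (m : M) : frob := frob_class [:: (r, m)].

Lemma frob_classP x y : frob_class x = frob_class y <-> frob_rel x y.
Proof.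
split; first by move/eqmodP/frob_eqbP.
by move=> h; apply/eqmodP/frob_eqbP.
Qed.

Lemma frob_repr x : frob_class (repr x) = x.
Proof. exact: reprK. Qed.

Lemma frob_class_ind (P : frob -> Prop) :
  (forall x, P (frob_class x)) -> forall x, P x.
Proof. by move=> h x; rewrite -[x]frob_repr. Qed.

Definition frob_scale_seq (a : R) (x : seq (R * M)) : seq (R * M) :=
  [seq (a * rm.1, rm.2) | rm <- x].

Lemma frob_scale_seq_rel a x y :
  frob_rel x y -> frob_rel (frob_scale_seq a x) (frob_scale_seq a y).
Proof.
elim=> {x y} /=.
- by move=> x; apply: FrobRefl.
- by move=> x y _; apply: FrobSym.
- by move=> x y z _ h _; apply: FrobTrans.
- by move=> x x' y y' _ h _ h'; rewrite /frob_scale_seq !map_cat; apply: FrobCat.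
- by move=> x y; rewrite /frob_scale_seq !map_cat; apply: FrobCatC.
- by move=> m; rewrite mulr0; apply: Frob0.
- by move=> r r' m; rewrite mulrDr; apply: FrobDl.
- by move=> r m m'; apply: FrobDr.
- by move=> r s m; rewrite mulrA; apply: FrobBal.
Qed.

Definition frob_zero : frob := frob_class [::].
Definition frob_add (x y : frob) : frob := frob_class (repr x ++ repr y).
Definition frob_scale (a : R) (x : frob) : frob :=
  frob_class (frob_scale_seq a (repr x)).
Definition frob_opp (x : frob) : frob := frob_scale (-1) x.

Lemma frob_class_repr x : frob_rel (repr (frob_class x)) x.
Proof. by apply/frob_classP; rewrite frob_repr. Qed.

Lemma frob_add_class x y :
  frob_add (frob_class x) (frob_class y) = frob_class (x ++ y).
Proof. by apply/frob_classP/FrobCat; apply: frob_class_repr. Qed.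

Lemma frob_scale_class a x :
  frob_scale a (frob_class x) = frob_class (frob_scale_seq a x).
Proof. by apply/frob_classP/frob_scale_seq_rel/frob_class_repr. Qed.

Fact frob_addA : associative frob_add.
Proof.
elim/frob_class_ind=> x; elim/frob_class_ind=> y; elim/frob_class_ind=> z.
by rewrite !frob_add_class catA.
Qed.

Fact frob_addC : commutative frob_add.
Proof.
elim/frob_class_ind=> x; elim/frob_class_ind=> y.
by rewrite !frob_add_class; apply/frob_classP/FrobCatC.
Qed.

Fact frob_add0 : left_id frob_zero frob_add.
Proof. by elim/frob_class_ind=> x; rewrite frob_add_class. Qed.

Lemma frob_rel_catCA x y z : frob_rel (x ++ y ++ z) (y ++ x ++ z).
Proof. by rewrite !catA; exact: FrobCat (FrobCatC x y) (FrobRefl z). Qed.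

Lemma frob_rel_scaleD a b x :
  frob_rel (frob_scale_seq (a + b) x) (frob_scale_seq a x ++ frob_scale_seq b x).
Proof.
elim: x => [|[r m] x IH]; first exact: FrobRefl.
have h1 := FrobCat (FrobDl (a * r) (b * r) m) IH.
rewrite -mulrDl in h1.
apply: FrobTrans h1 _.
have h2 := frob_rel_catCA [:: (b * r, m)] (frob_scale_seq a x) (frob_scale_seq b x).
exact: FrobCat (FrobRefl [:: (a * r, m)]) h2.
Qed.

Lemma frob_rel_scale0 x : frob_rel (frob_scale_seq 0 x) [::].
Proof.
elim: x => [|[r m] x IH] /=; first exact: FrobRefl.
by rewrite mul0r; apply: (FrobCat (Frob0 m) IH).
Qed.

Fact frob_scale1 : left_id 1 frob_scale.
Proof.
elim/frob_class_ind=> x; rewrite frob_scale_class; congr frob_class.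
by rewrite -[RHS]map_id; apply: eq_map => -[r m] /=; rewrite mul1r.
Qed.

Fact frob_scaleA a b x : frob_scale a (frob_scale b x) = frob_scale (a * b) x.
Proof.
elim/frob_class_ind: x => x; rewrite !frob_scale_class; congr frob_class.
by rewrite /frob_scale_seq -map_comp; apply: eq_map => -[r m] /=; rewrite mulrA.
Qed.

Fact frob_scaleDr : right_distributive frob_scale frob_add.
Proof.
move=> a; elim/frob_class_ind=> x; elim/frob_class_ind=> y.
by rewrite !(frob_add_class, frob_scale_class) /frob_scale_seq map_cat.
Qed.

Fact frob_scaleDl x : {morph frob_scale^~ x : a b / a + b >-> frob_add a b}.
Proof.
move=> a b; elim/frob_class_ind: x => x.
rewrite !frob_scale_class frob_add_class.
exact/frob_classP/frob_rel_scaleD.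
Qed.

Fact frob_addN : left_inverse frob_zero frob_opp frob_add.
Proof.
move=> x; rewrite /frob_opp -{2}[x]frob_scale1 -frob_scaleDl addNr.
elim/frob_class_ind: x => x; rewrite frob_scale_class.
exact/frob_classP/frob_rel_scale0.
Qed.

HB.instance Definition _ :=
  GRing.isZmodule.Build frob frob_addA frob_addC frob_add0 frob_addN.

HB.instance Definition _ :=
  GRing.Zmodule_isLmodule.Build R frob
    frob_scaleA frob_scale1 frob_scaleDr frob_scaleDl.

End FrobeniusTensor.

Section FrobeniusMap.
Variables (R : comNzRingType) (p : nat) (M N : lmodType R).
Variable f : {linear M -> N}.

Definition frob_map_seq (x : seq (R * M)) : seq (R * N) :=
  [seq (rm.1, f rm.2) | rm <- x].

Lemma frob_map_seq_rel x y :
  frob_rel p x y -> frob_rel p (frob_map_seq x) (frob_map_seq y).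
Proof.
elim=> {x y} /=.
- by move=> x; apply: FrobRefl.
- by move=> x y _; apply: FrobSym.
- by move=> x y z _ h _; apply: FrobTrans.
- by move=> x x' y y' _ h _ h'; rewrite /frob_map_seq !map_cat; apply: FrobCat.
- by move=> x y; rewrite /frob_map_seq !map_cat; apply: FrobCatC.
- by move=> m; apply: Frob0.
- by move=> r r' m; apply: FrobDl.
- by move=> r m m'; rewrite linearD; apply: FrobDr.
- by move=> r s m; rewrite linearZ; apply: FrobBal.
Qed.

Definition frob_map (x : frob p M) : frob p N :=
  frob_class p (frob_map_seq (repr x)).

Lemma frob_map_class x :
  frob_map (frob_class p x) = frob_class p (frob_map_seq x).
Proof. by apply/frob_classP/frob_map_seq_rel/frob_class_repr. Qed.

Fact frob_map_linear : linear frob_map.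
Proof.
move=> a; elim/frob_class_ind=> x; elim/frob_class_ind=> y.
rewrite [a *: _]frob_scale_class [_ + frob_class p y]frob_add_class.
rewrite !frob_map_class [a *: _]frob_scale_class.
rewrite [_ + frob_class p (frob_map_seq y)]frob_add_class.
by rewrite /frob_map_seq map_cat /frob_scale_seq -!map_comp.
Qed.

HB.instance Definition _ :=
  GRing.isLinear.Build R (frob p M) (frob p N) _ frob_map frob_map_linear.

End FrobeniusMap.

Arguments frob_map {R} p {M N} f x.

Fixpoint frob_iter (R : comNzRingType) (p e : nat) (U : lmodType R) : lmodType R :=
  if e is e'.+1 then frob p (frob_iter p e' U) else U.

(* The e-th iterate of the functor applied to [beta]. *)
Fixpoint frob_trans (R : comNzRingType) (p : nat) (U : lmodType R)
    (beta : {linear U -> frob p U}) (e : nat) :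
    {linear frob_iter p e U -> frob_iter p e.+1 U} :=
  match e return {linear frob_iter p e U -> frob_iter p e.+1 U} with
  | 0 => beta
  | e'.+1 => frob_map p (frob_trans beta e')
  end.

Section DirectLimit.
Variables (R : comNzRingType) (V : nat -> lmodType R).
Variable tr : forall e, {linear V e -> V e.+1}.

Definition cocone (N : lmodType R) (c : forall e, {linear V e -> N}) : Prop :=
  forall e x, c e.+1 (tr e x) = c e x.

Definition is_direct_limit (M : lmodType R) (c : forall e, {linear V e -> M}) : Prop :=
  cocone c /\
  forall (N : lmodType R) (g : forall e, {linear V e -> N}), cocone g ->
    exists h : {linear M -> N}, (forall e x, h (c e x) = g e x) /\
      forall h' : {linear M -> N}, (forall e x, h' (c e x) = g e x) -> h' =1 h.

End DirectLimit.

Section Gradings.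
Variables (G : zmodType) (R : comNzRingType) (degR : G -> R -> Prop).

(* [D u] is the homogeneous component of degree [u]. *)
Definition is_grading (M : lmodType R) (D : G -> M -> Prop) : Prop :=
  [/\ forall u, D u 0 /\ (forall x y, D u x -> D u y -> D u (x - y)),
      forall u v r x, degR u r -> D v x -> D (u + v) (r *: x),
      forall x, exists (s : seq G) (f : G -> M),
        [/\ uniq s, forall u, D u (f u) & x = \sum_(u <- s) f u] &
      forall (s : seq G) (f : G -> M), uniq s -> (forall u, D u (f u)) ->
        \sum_(u <- s) f u = 0 -> forall u, u \in s -> f u = 0].

Definition degree_preserving (M N : lmodType R) (D : G -> M -> Prop)
    (D' : G -> N -> Prop) (f : M -> N) : Prop :=
  forall u x, D u x -> D' u (f x).

(* deg (r (x) m) = deg r + p deg m *)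
Definition frob_deg (p : nat) (M : lmodType R) (D : G -> M -> Prop)
    (u : G) (x : frob p M) : Prop :=
  exists s : seq (R * M),
    (forall rm, rm \in s ->
       exists v w, [/\ degR v rm.1, D w rm.2 & u = v + w *+ p]) /\
    x = \sum_(rm <- s) tens p rm.1 rm.2.

Fixpoint frob_iter_deg (p e : nat) (U : lmodType R) (D : G -> U -> Prop) :
    G -> frob_iter p e U -> Prop :=
  match e return G -> frob_iter p e U -> Prop with
  | 0 => D
  | e'.+1 => @frob_deg p _ (@frob_iter_deg p e' U D)
  end.

End Gradings.

(* [theta] is the isomorphism induced on the direct limit, identifying
   F(lim F^e(U)) with lim F^(e+1)(U). *)
Definition F_finite_via (R : comNzRingType) (p : nat) (M : lmodType R)
    (theta : {linear M -> frob p M}) (U : lmodType R)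
    (beta : {linear U -> frob p U})
    (c : forall e, {linear frob_iter p e U -> M}) : Prop :=
  [/\ finitely_generated U,
      is_direct_limit (frob_trans beta) c &
      forall e (y : frob_iter p e.+1 U), theta (c e.+1 y) = frob_map p (c e) y].

(* The grading of M is the one inherited from the direct system. *)
Definition graded_F_finite (G : zmodType) (R : comNzRingType)
    (degR : G -> R -> Prop) (p : nat) (M : lmodType R)
    (D : G -> M -> Prop) (theta : {linear M -> frob p M}) : Prop :=
  is_grading degR D /\ bijective theta /\
  exists (U : lmodType R) (beta : {linear U -> frob p U})
    (c : forall e, {linear frob_iter p e U -> M}) (DU : G -> U -> Prop),
    [/\ F_finite_via theta beta c,
        is_grading degR DU,
        degree_preserving DU (frob_deg degR DU) beta &
        forall e, degree_preserving (frob_iter_deg degR DU) D (c e)].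

(* The component of degree u of A[X_1,...,X_n]; it is 0 when some u_i < 0. *)
Definition mpoly_deg (A : comNzRingType) (n : nat) (u : {ffun 'I_n -> int})
    (r : {mpoly A[n]}) : Prop :=
  forall m : 'X_{1..n}, m \in msupp r -> forall i, u i = (m i)%:Z.

(* Main.v *)
Require Import Defs.
From HB Require Import structures.
From mathcomp Require Import all_boot all_order all_algebra ssrcomplements zify.

Set Implicit Arguments.
Unset Strict Implicit.
Unset Printing Implicit Defensive.

Import GRing.Theory Num.Theory.
Local Open Scope ring_scope.

(** The structure isomorphism theta turns M into a module with a p-semilinear
    Frobenius action f m = theta^-1 (1 (x) m), and bijectivity of theta says
    that M is the universal Frobenius twist of itself.  Iterating, for q = p ^ e
    every map that is additive in r and in m and satisfies
    b (r * s ^ q, m) = b (r, s m) factors through (r, m) |-> r * f^e m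
    ([frob_act_lift]).  Hence every additive map phi : R -> R that is linear
    over the q-th powers acts on M by r * f^e m |-> phi r * f^e m.

    As M is the limit of the twists of U, it is additively spanned by elements m
    that are homogeneous of some degree w and whose iterates f^k m are
    homogeneous of degree p^k w ([frob_homog_span]).  Consequently M is
    additively spanned by the elements z = d X^b f^e m with m of this kind, for
    any e, and it is enough to kill these for one large e.  The degree of z is
    b + q w.  Write b = q k + a with 0 <= a_i < q.  Replacing the residue a by
    another residue a' keeps the i-th degree in the block
    [q v_i, q v_i + q - 1], where v = k + w.  As soon as q > N + 1, each such
    block has an endpoint of absolute value > N: the upper one if v_i >= 0, the
    lower one if v_i < 0.  Choosing a' accordingly puts d X^(q k + a') f^e m in
    a degree where M vanishes.  The map phi that sends X^m to X^(m - a' + a)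
    when m has residue a', and to 0 otherwise, is linear over the q-th powers
    ([block_shiftM]), so it acts on M; it carries 0 = d X^(q k + a') f^e m back
    to z, and z = 0. *)

(** * Additive spans *)

(** Common form of decompositions into homogeneous elements, simple tensors or
    monomials: an additive statement about V can be checked on the elements
    satisfying P, without choosing a decomposition. *)
Inductive add_span (V : nmodType) (P : V -> Prop) : V -> Prop :=
| AddSpan0 : add_span P 0
| AddSpanD x y : add_span P x -> add_span P y -> add_span P (x + y)
| AddSpanGen x : P x -> add_span P x.

Lemma add_span_sum (V : nmodType) (P : V -> Prop) (I : eqType) (s : seq I)
    (F : I -> V) :
  (forall i, i \in s -> add_span P (F i)) -> add_span P (\sum_(i <- s) F i).
Proof.
move=> spanF; rewrite big_seq.
by elim/big_ind: _ => //; [apply: AddSpan0 | apply: AddSpanD].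
Qed.

Lemma morph_add0 (V : nmodType) (W : zmodType) (f : V -> W) :
  {morph f : x y / x + y} -> f 0 = 0.
Proof. by move=> fD; apply: (addrI (f 0)); rewrite -fD !addr0. Qed.

Lemma add_span_bind (V : nmodType) (W : zmodType) (P : V -> Prop)
    (Q : W -> Prop) (f : V -> W) x :
  {morph f : x y / x + y} ->
  (forall x, P x -> add_span Q (f x)) -> add_span P x -> add_span Q (f x).
Proof.
move=> fD PQ; elim=> {x} [|x y _ IHx _ IHy|x /PQ //].
  by rewrite morph_add0 //; apply: AddSpan0.
by rewrite fD; apply: AddSpanD.
Qed.

Lemma add_span_eq (V : nmodType) (W : zmodType) (P : V -> Prop)
    (f g : V -> W) x :
  {morph f : x y / x + y} -> {morph g : x y / x + y} ->
  (forall x, P x -> f x = g x) -> add_span P x -> f x = g x.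
Proof.
move=> fD gD fg; elim=> {x} [|x y _ IHx _ IHy|x /fg //].
  by rewrite !morph_add0.
by rewrite fD gD IHx IHy.
Qed.

(** * The universal property of the Frobenius functor *)

Section FrobeniusUniversal.
Variables (R : comNzRingType) (p : nat) (M : lmodType R).

Lemma frob_class_sum (s : seq (R * M)) :
  frob_class p s = \sum_(rm <- s) tens p rm.1 rm.2.
Proof.
elim: s => [|[r m] s IHs]; first by rewrite big_nil.
by rewrite big_cons -IHs; symmetry; apply: (frob_add_class p [:: (r, m)] s).
Qed.

Lemma frob_span (x : frob p M) :
  add_span (fun y => exists r m, y = tens p r m) x.
Proof.
elim/frob_class_ind: x => s; rewrite frob_class_sum.
by apply: add_span_sum => -[r m] _; apply: AddSpanGen; exists r, m.
Qed.

Lemma tensZ a r (m : M) : a *: tens p r m = tens p (a * r) m.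
Proof. exact: (frob_scale_class p a [:: (r, m)]). Qed.

Lemma tensDr r (m m' : M) : tens p r (m + m') = tens p r m + tens p r m'.
Proof.
rewrite [RHS](frob_add_class p [:: (r, m)] [:: (r, m')]).
exact/frob_classP/FrobDr.
Qed.

Lemma tensDl r r' (m : M) : tens p (r + r') m = tens p r m + tens p r' m.
Proof.
rewrite [RHS](frob_add_class p [:: (r, m)] [:: (r', m)]).
exact/frob_classP/FrobDl.
Qed.

Lemma tens_bal r s (m : M) : tens p (r * s ^+ p) m = tens p r (s *: m).
Proof. exact/frob_classP/FrobBal. Qed.

Lemma frob_map_tens (N : lmodType R) (h : {linear M -> N}) r m :
  frob_map p h (tens p r m) = tens p r (h m).
Proof. exact: (frob_map_class p h [:: (r, m)]). Qed.

(** For N an additive group, these are the maps that factor through the tensor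
    product of M with R, the latter being a right module via s |-> s ^ q. *)
Definition balanced (q : nat) (N : zmodType) (b : R -> M -> N) : Prop :=
  [/\ forall m, {morph b^~ m : r r' / r + r'},
      forall r, {morph b r : m m' / m + m'} &
      forall r s m, b (r * s ^+ q) m = b r (s *: m)].

Lemma frob_lift (N : zmodType) (b : R -> M -> N) : balanced p b ->
  exists Phi : frob p M -> N,
    {morph Phi : x y / x + y} /\ forall r m, Phi (tens p r m) = b r m.
Proof.
case=> bDl bDr bB; pose S (s : seq (R * M)) := \sum_(rm <- s) b rm.1 rm.2.
have Srel s s' : frob_rel p s s' -> S s = S s'.
  rewrite /S; elim=> {s s'} //=.
  - by move=> s s' s'' _ -> _ ->.
  - by move=> s s' t t' _ IH _ IH'; rewrite !big_cat IH IH'.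
  - by move=> s s'; rewrite !big_cat /= addrC.
  - move=> m; rewrite big_seq1 big_nil.
    by apply: (addrI (b 0 m)); rewrite -bDl !addr0.
  - by move=> r r' m; rewrite !(big_cons, big_nil) !addr0 bDl.
  - by move=> r m m'; rewrite !(big_cons, big_nil) !addr0 bDr.
  - by move=> r s m; rewrite !big_seq1 bB.
have SE s : S (repr (frob_class p s)) = S s by exact/Srel/frob_class_repr.
exists (fun x => S (repr x)); split=> [|r m]; last by rewrite SE /S big_seq1.
elim/frob_class_ind=> s; elim/frob_class_ind=> t.
by rewrite [_ + _]frob_add_class !SE /S big_cat.
Qed.

End FrobeniusUniversal.

(** * The Frobenius action of an F-module *)

Section FrobeniusAction.
Variables (R : comNzRingType) (p : nat) (charR : p \in [pchar R]).
Variables (M : lmodType R) (theta : {linear M -> frob p M}).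
Variables (theta' : frob p M -> M).
Variables (thetaK : cancel theta theta') (theta'K : cancel theta' theta).

Definition frob_act (m : M) : M := theta' (tens p 1 m).

Lemma theta'D : {morph theta' : x y / x + y}.
Proof. by move=> x y; apply: (can_inj thetaK); rewrite linearD !theta'K. Qed.

Lemma theta'_tens r m : theta' (tens p r m) = r *: frob_act m.
Proof.
by apply: (can_inj thetaK); rewrite linearZ /= /frob_act !theta'K tensZ mulr1.
Qed.

Lemma frob_actD : {morph frob_act : x y / x + y}.
Proof. by move=> x y; rewrite /frob_act tensDr theta'D. Qed.

Lemma frob_actZ s m : frob_act (s *: m) = s ^+ p *: frob_act m.
Proof. by rewrite -theta'_tens /frob_act -tens_bal mul1r. Qed.

Lemma iter_frob_actD e : {morph iter e frob_act : x y / x + y}.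
Proof. by elim: e => [|e IHe] x y; rewrite ?iterS ?IHe ?frob_actD. Qed.

Lemma iter_frob_actZ e s m :
  iter e frob_act (s *: m) = s ^+ (p ^ e) *: iter e frob_act m.
Proof.
elim: e => [|e IHe] /=; first by rewrite expr1.
by rewrite IHe frob_actZ -exprM expnSr.
Qed.

Lemma frob_act_span e x :
  add_span (fun y => exists r m, y = r *: iter e frob_act m) x.
Proof.
elim: e x => [|e IHe] x.
  by apply: AddSpanGen; exists 1, x; rewrite scale1r.
rewrite -[x]thetaK.
apply: add_span_bind (frob_span (theta x)) => [|_ [r [m ->]]].
  exact: theta'D.
rewrite theta'_tens.
apply: (@add_span_bind _ _ _ _ (fun m => r *: frob_act m)) (IHe m).
  by move=> y z /=; rewrite frob_actD scalerDr.
move=> _ [s [m' ->]] /=; apply: AddSpanGen; exists (r * s ^+ p), m'.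
by rewrite frob_actZ scalerA.
Qed.

(** M has the universal property of its own e-th Frobenius twist: the bijection
    theta identifies M with one twist of M, and the coefficient of a twist of a
    twist is absorbed by r (x) (s (x) m) |-> r s^p (x) m.  Working with this
    property of M avoids comparing iterated twists with a twist by p ^ e. *)
Lemma frob_act_lift e (N : zmodType) (b : R -> M -> N) : balanced (p ^ e) b ->
  exists Phi : M -> N, {morph Phi : x y / x + y} /\
    forall r m, Phi (r *: iter e frob_act m) = b r m.
Proof.
elim: e b => [|e IHe] b [bDl bDr bB].
  exists (b 1); split=> // r m.
  by rewrite -bB mul1r expr1.
have bal_r r : balanced (p ^ e) (fun s m => b (r * s ^+ p) m).
  split=> [m s s'|s m m'|s t m]; last 2 first.
  - exact: bDr.
  - by rewrite exprMn -exprM mulnC -expnS mulrA bB.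
  rewrite -bDl -mulrDr.
  by rewrite -[LHS]/(b (r * pFrobenius_aut charR (s + s')) m) rmorphD.
(* Fixing the outer coefficient r, the inner twist is handled by induction;
   the resulting maps are determined by their values on the elements
   s * f^e m, and so depend on r in a balanced way. *)
have [Phi PhiP] := choice (fun r => IHe _ (bal_r r)).
have [|Psi [PsiD PsiE]] := @frob_lift R p M N Phi.
  split=> [m r r'|r|r t m]; last 2 first.
  - by case: (PhiP r).
  - case: (PhiP r) => rD rE; case: (PhiP (r * t ^+ p)) => tD tE.
    apply: (@add_span_eq _ _ _ _ (fun m => Phi r (t *: m)))
      (frob_act_span e m) => [//|x y|_ [s [m' ->]]].
      by rewrite scalerDr rD.
    by rewrite tE scalerA rE exprMn mulrA.
  case: (PhiP r) => rD rE; case: (PhiP r') => rD' rE'.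
  case: (PhiP (r + r')) => sD sE.
  apply: (@add_span_eq _ _ _ _ (fun m => Phi r m + Phi r' m))
      (frob_act_span e m) => [//|x y|_ [s [m' ->]]].
    by rewrite rD rD' addrACA.
  by rewrite sE rE rE' -bDl mulrDl.
exists (Psi \o theta); split=> [x y|r m] /=; first by rewrite linearD PsiD.
rewrite -theta'_tens theta'K PsiE -[iter e _ m]scale1r.
by case: (PhiP r) => _ ->; rewrite expr1n mulr1.
Qed.

End FrobeniusAction.

(** * Homogeneous elements of a graded F-finite module *)

(** The structure maps of a direct limit are jointly surjective: if they land in
    a submodule Q, they induce a map from the limit to Q, whose composite with
    the inclusion is the identity by uniqueness. *)
Lemma direct_limit_ind (R : comNzRingType) (V : nat -> lmodType R)
    (tr : forall e, {linear V e -> V e.+1}) (M : lmodType R)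
    (c : forall e, {linear V e -> M}) (Q : M -> Prop) :
  is_direct_limit tr c -> Q 0 -> (forall x y, Q x -> Q y -> Q (x + y)) ->
  (forall r x, Q x -> Q (r *: x)) -> (forall e y, Q (c e y)) ->
  forall x, Q x.
Proof.
move=> [cM univ] Q0 QD QZ Qc.
pose S : {pred M} := fun x => `[< Q x >].
have S_closed : GRing.submod_closed S.
  split=> [|r x y /asboolP Qx /asboolP Qy]; apply/asboolP => //.
  exact/QD/Qy/QZ.
pose HS := GRing.isSubmodClosed.Build R M S S_closed.
pose S' : submodClosed M := HB.pack S HS.
pose N0 := {x : M | x \in S'}.
pose L := [SubChoice_isSubLmodule of N0 by <:].
pose N : lmodType R := HB.pack N0 L.
have vD : linear (val : N -> M) by move=> r x y.
pose v : {linear N -> M} :=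
  HB.pack (val : N -> M) (GRing.isLinear.Build R N M *:%R _ vD).
have Sc e y : c e y \in S' by apply/asboolP.
pose g e (y : V e) : N := Sub (c e y) (Sc e y).
have gL e : linear (@g e) by move=> r x y; apply: val_inj; rewrite /= linearP.
pose gl e : {linear V e -> N} :=
  HB.pack (@g e) (GRing.isLinear.Build R (V e) N *:%R _ (gL e)).
have [|h [hE _]] := univ N gl.
  by move=> e x; apply: val_inj; rewrite /= cM.
have [h0 [_ h0U]] := univ M c cM.
move=> x; apply/asboolP.
have -> : x = v (h x).
  rewrite [LHS](h0U idfun) //.
  by rewrite -[RHS]/((v \o h) x) h0U // => e y /=; rewrite hE.
exact: valP (h x).
Qed.

Section GradedSpan.
Variables (G : zmodType) (R : comNzRingType) (degR : G -> R -> Prop).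
Variables (degR1 : degR 0 1)
  (degRM : forall u v r s, degR u r -> degR v s -> degR (u + v) (r * s))
  (degR_span : forall r, add_span (fun s => exists u, degR u s) r).

Lemma degRX u r k : degR u r -> degR (u *+ k) (r ^+ k).
Proof.
by move=> degr; elim: k => [//|k IHk]; rewrite mulrS exprS; apply: degRM.
Qed.

Lemma grading_span (M : lmodType R) (D : G -> M -> Prop) x :
  is_grading degR D -> add_span (fun y => exists u, D u y) x.
Proof.
case=> _ _ /(_ x) [s [f [_ Df ->]]] _.
by apply: add_span_sum => u _; apply: AddSpanGen; exists u.
Qed.

Lemma frob_deg_span p (M : lmodType R) (D : G -> M -> Prop) :
  (forall x : M, add_span (fun y => exists u, D u y) x) ->
  forall x : frob p M, add_span (fun y => exists u, frob_deg degR D u y) x.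
Proof.
move=> spanM x; elim: x / (frob_span x) => [|x y _ IHx _ IHy|_ [r [m ->]]].
- exact: AddSpan0.
- exact: AddSpanD.
apply: (@add_span_bind _ _ _ _ (tens p r)) (spanM m) => [m1 m2|m' [w Dm']].
  exact: tensDr.
apply: (@add_span_bind _ _ _ _ (fun r => tens p r m')) (degR_span r).
  by move=> r1 r2; apply: tensDl.
move=> s [v degs]; apply: AddSpanGen; exists (v + w *+ p), [:: (s, m')].
split; last by rewrite big_seq1.
by move=> _ /[1!inE]/eqP->; exists v, w.
Qed.

Lemma frob_iter_deg_span p e (U : lmodType R) (D : G -> U -> Prop) :
  is_grading degR D -> forall x : frob_iter p e U,
  add_span (fun y => exists u, frob_iter_deg degR D u y) x.
Proof.
move=> grD; elim: e => [x|e IHe] /=; first exact: grading_span grD.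
exact: frob_deg_span.
Qed.

Variables (p : nat) (M : lmodType R) (theta : {linear M -> frob p M}).
Variables (theta' : frob p M -> M).
Variables (thetaK : cancel theta theta') (theta'K : cancel theta' theta).
Variables (D : G -> M -> Prop) (grD : is_grading degR D).

(** Homogeneous elements whose whole Frobenius orbit is homogeneous of the
    expected degrees.  Asking for all iterates at once makes the span of these
    elements a submodule that contains every image of the direct system, hence
    all of M; this is how theta respects the gradings. *)
Definition frob_homog (w : G) (m : M) : Prop :=
  forall k, D (w *+ p ^ k) (iter k (frob_act theta') m).

Lemma frob_homogZ v w r m :
  degR v r -> frob_homog w m -> frob_homog (v + w) (r *: m).
Proof.
move=> degr hm k; rewrite (iter_frob_actZ thetaK) // mulrnDl.
by case: grD => _ DZ _ _; apply: DZ => //; apply: degRX.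
Qed.

Variables (U : lmodType R) (beta : {linear U -> frob p U}).
Variables (c : forall e, {linear frob_iter p e U -> M}) (DU : G -> U -> Prop).
Variables (viaU : F_finite_via theta beta c) (grDU : is_grading degR DU).
Variable (cD : forall e, degree_preserving (frob_iter_deg degR DU) D (c e)).

(** The Frobenius action shifts the direct system by one step:
    f (c_e y) = c_(e+1) (1 (x) y), and 1 (x) y has degree p w when y has
    degree w. *)
Lemma limit_frob_homog e w y :
  frob_iter_deg degR DU w y -> frob_homog w (c e y).
Proof.
move=> Dy k; elim: k => [|k IHk] in e w y Dy *; first exact: cD.
have actc : frob_act theta' (c e y) = c e.+1 (tens p 1 y).
  case: viaU => _ _ cE; apply: (can_inj thetaK).
  by rewrite theta'K cE frob_map_tens.
rewrite iterSr actc expnS mulrnA; apply: IHk => /=.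
exists [:: (1, y)]; split; last by rewrite big_seq1.
by move=> _ /[1!inE]/eqP->; exists 0, w; rewrite add0r.
Qed.

(** The span is a submodule, as f^k (r m) = r^(p^k) f^k m, and it contains the
    images of the direct system; the limit is generated by these images. *)
Lemma frob_homog_span x : add_span (fun m => exists w, frob_homog w m) x.
Proof.
case: viaU => _ limM _.
apply: (direct_limit_ind limM) => {x} [|x y|r x spanx|e y].
- exact: AddSpan0.
- exact: AddSpanD.
- apply: (@add_span_bind _ _ _ _ ( *:%R r)) spanx => [m m'|m [w hm]].
    exact: scalerDr.
  apply: (@add_span_bind _ _ _ _ ( *:%R^~ m)) (degR_span r).
    by move=> s s'; apply: scalerDl.
  by move=> s [v degs]; apply: AddSpanGen; exists (v + w); apply: frob_homogZ.
apply: (@add_span_bind _ _ _ _ (c e)) (frob_iter_deg_span grDU y).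
  exact: linearD.
by move=> z [w Dz]; apply: AddSpanGen; exists w; apply: limit_frob_homog.
Qed.

End GradedSpan.

(** * Polynomial rings and shifts inside a block of exponents *)

Section MonomialMap.
Variables (n : nat) (A : comNzRingType) (h : 'X_{1..n} -> {mpoly A[n]}).

Definition monomial_map (r : {mpoly A[n]}) : {mpoly A[n]} :=
  \sum_(m <- msupp r) r@_m *: h m.

Lemma monomial_mapE k r : (msize r <= k)%N ->
  monomial_map r = \sum_(m : 'X_{1..n < k}) r@_m *: h m.
Proof.
move=> ler; pose I := 'X_{1..n < k}.
rewrite /monomial_map (big_mksub I) ?msupp_uniq //=; last first.
  by move=> m /msize_mdeg_lt /leq_trans; apply.
by rewrite big_rmcond //= => m /memN_msupp_eq0 ->; rewrite scale0r.
Qed.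

Lemma monomial_mapD : {morph monomial_map : r s / r + s}.
Proof.
move=> r s; pose k := maxn (msize (r + s)) (maxn (msize r) (msize s)).
rewrite !(@monomial_mapE k) ?leq_max ?leqnn ?orbT //.
by rewrite -big_split; apply: eq_bigr => m _; rewrite mcoeffD scalerDl.
Qed.

Lemma monomial_mapX c m : monomial_map (c *: 'X_[m]) = c *: h m.
Proof.
have [->|c0] := eqVneq c 0; last first.
  by rewrite /monomial_map msuppMCX // big_seq1 mcoeffZ mcoeffX eqxx mulr1.
by rewrite !scale0r morph_add0 //; apply: monomial_mapD.
Qed.

End MonomialMap.

Lemma mpoly_monomial_span n (A : comNzRingType) (r : {mpoly A[n]}) :
  add_span (fun s => exists c m, s = c *: 'X_[m]) r.
Proof.
rewrite [r]mpolyE; apply: add_span_sum => m _.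
by apply: AddSpanGen; exists r@_m, m.
Qed.

Lemma mpoly_deg1 n (A : comNzRingType) : @mpoly_deg A n 0 1.
Proof.
by move=> m; rewrite -mpolyC1 msupp1 inE => /eqP-> i; rewrite ffunE mnm0E.
Qed.

Lemma mpoly_degM n (A : comNzRingType) u v (r s : {mpoly A[n]}) :
  mpoly_deg u r -> mpoly_deg v s -> mpoly_deg (u + v) (r * s).
Proof.
move=> ru sv m /msuppM_le/allpairsP[[m1 m2] /= [/ru u1 /sv v2 ->]] i.
by rewrite ffunE u1 v2 mnmDE PoszD.
Qed.

Definition mnm_deg n (m : 'X_{1..n}) : {ffun 'I_n -> int} :=
  [ffun i => (m i)%:Z].

Lemma mpoly_degX n (A : comNzRingType) (c : A) (m : 'X_{1..n}) :
  mpoly_deg (mnm_deg m) (c *: 'X_[m]).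
Proof.
by move=> m' /msuppZ_le; rewrite msuppX inE => /eqP-> i; rewrite ffunE.
Qed.

Lemma mpoly_deg_span n (A : comNzRingType) (r : {mpoly A[n]}) :
  add_span (fun s => exists u, mpoly_deg u s) r.
Proof.
elim: r / (mpoly_monomial_span r) => [|r s _ IHr _ IHs|_ [c [m ->]]].
- exact: AddSpan0.
- exact: AddSpanD.
by apply: AddSpanGen; exists (mnm_deg m); apply: mpoly_degX.
Qed.

Section BlockShift.
Variables (n : nat) (A : comNzRingType) (q : nat) (a a' : 'X_{1..n}).

(** Moves monomials within a block of exponents of length q, from the residues
    a' to the residues a; the other monomials are killed so that the map is
    linear over q-th powers.  The truncated subtraction is harmless, since
    a' <= m whenever m has residues a'. *)
Definition block_shift : {mpoly A[n]} -> {mpoly A[n]} :=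
  monomial_map (fun m =>
    if [forall i, (m i %% q == a' i)%N] then 'X_[m - a' + a] else 0).

(** Multiplying by the q-th power of a monomial does not change the residues of
    the exponents modulo q, and q-th powers are additive. *)
Lemma block_shiftM r s : [pchar {mpoly A[n]}].-nat q ->
  block_shift (r * s ^+ q) = block_shift r * s ^+ q.
Proof.
move=> qnat.
have SD : {morph block_shift : x y / x + y} by apply: monomial_mapD.
apply: (@add_span_eq _ _ _ (fun r => block_shift (r * s ^+ q))
    (fun r => block_shift r * s ^+ q)) (mpoly_monomial_span r).
- by move=> x y /=; rewrite mulrDl SD.
- by move=> x y /=; rewrite SD mulrDl.
move=> _ [c [m ->]].
apply: (@add_span_eq _ _ _ (fun s => block_shift (c *: 'X_[m] * s ^+ q))
    (fun s => block_shift (c *: 'X_[m]) * s ^+ q)) (mpoly_monomial_span s).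
- by move=> x y /=; rewrite exprDn_pchar // mulrDr SD.
- by move=> x y /=; rewrite exprDn_pchar // mulrDr.
move=> _ [d [k ->]].
rewrite exprZn mpolyXn -scalerAl -scalerAr scalerA -mpolyXD /block_shift.
rewrite !monomial_mapX -scalerAl -scalerAr scalerA; congr (_ *: _).
have -> : [forall i, ((m + k *+ q)%MM i %% q == a' i)%N] =
          [forall i, (m i %% q == a' i)%N].
  apply: eq_forallb => i; rewrite mnmDE mulmnE.
  by rewrite addnC modnMDl.
case: ifP => [/forallP ma'|_]; last by rewrite mul0r.
rewrite -mpolyXD; congr 'X_[_]; apply/mnmP => i.
have := ma' i; have := leq_mod (m i) q.
rewrite !(mnmDE, mnmBE, mulmnE); lia.
Qed.

End BlockShift.

Theorem theoremA (p n : nat) (A : comNzRingType) (K : fieldType)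
  (iota : {rmorphism K -> A}) (charK : p \in [pchar K])
  (regA : regular_ring A)
  (M : lmodType {mpoly A[n]}) (theta : {linear M -> frob p M})
  (Mdeg : {ffun 'I_n -> int} -> M -> Prop)
  (grM : graded_F_finite (@mpoly_deg A n) Mdeg theta)
  (vanish : exists N : nat, forall u : {ffun 'I_n -> int},
     (forall i : 'I_n, (N < `|u i|)%N) -> forall x : M, Mdeg u x -> x = 0) :
  forall x : M, x = 0.
Proof.
have p_pr := pcharf_prime charK.
have charR : p \in [pchar {mpoly A[n]}].
  exact: (rmorph_pchar (mpolyC n (R:=A)) (rmorph_pchar iota charK)).
case: vanish => N van.
case: grM => grD [[theta' thetaK theta'K] [U [beta [c [DU [via grDU _ cD]]]]]].
(* Any exponent e with p ^ e > N + 1 would do. *)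
pose q := (p ^ N.+2)%N.
have qN : (N.+2 < q)%N by apply: ltn_expl; apply: prime_gt1.
have qnat : [pchar {mpoly A[n]}].-nat q.
  by rewrite pnatX (pnatE _ p_pr) charR.
pose F := iter N.+2 (frob_act theta').
have FD : {morph F : y z / y + z} by apply: iter_frob_actD.
have term0 (b : 'X_{1..n}) m w (d : A) :
    frob_homog theta' Mdeg w m -> (d *: 'X_[b]) *: F m = 0.
  move=> hm; pose a : 'X_{1..n} := [multinom (b i %% q)%N | i < n].
  pose a' : 'X_{1..n} :=
    [multinom (if ((0 : int) <= (b i %/ q)%N%:Z + w i)%R then q.-1 else 0%N)
    | i < n].
  pose b' : 'X_{1..n} := [multinom ((b i %/ q) * q + a' i)%N | i < n].
  have a'q i : (a' i < q)%N by rewrite mnmE; case: ifP => _; lia.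
  have b'0 : (d *: 'X_[b']) *: F m = 0.
    case: grD => _ DZ _ _.
    apply: (van _ _ _ (DZ _ _ _ _ (@mpoly_degX n A d b') (hm N.+2))).
    move=> i; rewrite !ffunE ffunMnE !mnmE -/q.
    (* The i-th degree is q v + a', where v = b %/ q + w: it is q v + q - 1
       if v >= 0, and q v <= - q otherwise. *)
    rewrite -mulr_natr natz.
    move: (b i %/ q)%N (w i) qN => k wi; clear; case: ifP => v_ge0 qN.
      have : (0 <= (k%:Z + wi) * q%:Z)%R by apply: mulr_ge0.
      by lia.
    have : (0 <= (- (k%:Z + wi) - 1) * q%:Z)%R by apply: mulr_ge0; lia.
    by lia.
  (* Phi undoes the change of residues: it maps the element with exponent b',
     which is 0, to the one with exponent b. *)
  have [|Phi [PhiD PhiE]] :=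
    @frob_act_lift _ p charR M theta theta' thetaK theta'K N.+2 M
      (fun r m => block_shift q a a' r *: F m).
    split=> [y r s|r y z|r s y].
    - by rewrite /block_shift monomial_mapD scalerDl.
    - by rewrite FD scalerDr.
    by rewrite block_shiftM // /F (iter_frob_actZ thetaK) // scalerA.
  move: (PhiE (d *: 'X_[b']) m); rewrite b'0 morph_add0 // => ->.
  rewrite /block_shift monomial_mapX ifT; last first.
    by apply/forallP => i; rewrite [b' i]mnmE modnMDl modn_small.
  congr (_ *: 'X_[_] *: _); apply/mnmP => i.
  by rewrite mnmDE mnmBE [b' i]mnmE [a i]mnmE addnK -divn_eq.
move=> x; apply: (@add_span_eq _ _ _ idfun (fun=> 0)
  _ _ _ _ (frob_act_span thetaK theta'K N.+2 x)) => // [y z|_ [r [m ->]]].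
  by rewrite addr0.
apply: (@add_span_eq _ _ _ (fun r => r *: F m) (fun=> 0) _ _ _ _
  (mpoly_monomial_span r)) => [y z|y z|_ [d [b ->]]].
- exact: scalerDl.
- by rewrite addr0.
have := frob_homog_span (@mpoly_deg1 n A) (@mpoly_degM n A)
  (@mpoly_deg_span n A) thetaK theta'K grD via grDU cD m.
apply: (@add_span_eq _ _ _ (fun m => (d *: 'X_[b]) *: F m) (fun=> 0)).
- by move=> y z; rewrite FD scalerDr.
- by move=> y z; rewrite addr0.
by move=> y [w]; apply: term0.
Qed.
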